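(* For every sufficiently large integer $d$ divisible by $3$, $L(d)\ge d\cdot 3^{(d-6)/3}$.
   Context: A set $\mathcal{C}\subseteq\{0,1\}^n$ is a $(d,L,n)$-code (a $(d,L)$-list decodable erasure code of length $n$) if every $d$-dimensional subcube of $\{0,1\}^n$ (a set obtained by fixing the values of some $n-d$ coordinates and letting the other $d$ coordinates vary freely) contains at most $L$ elements of $\mathcal{C}$; equivalently, for every codeword, after erasing any $d$ of its bits the remaining part has at most $L$ completions to codewords. $L(d)$ denotes the smallest integer $L$ for which there exists $\varepsilon=\varepsilon(d)>0$ such that for every $n$ there is a $(d,L,n)$-code of cardinality at least $\varepsilon 2^n$. *)

(* Defs.v *)
From mathcomp Require Import all_boot all_order all_algebra.
From mathcomp Require Import boolp reals.

Set Implicit Arguments.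
Unset Strict Implicit.
Unset Printing Implicit Defensive.

Import Order.TTheory GRing.Theory Num.Theory.

Local Open Scope ring_scope.

Notation cube n := {ffun 'I_n -> bool}.

(* The subcube with free coordinates S; only the values of x outside S
   matter. *)
Definition subcube (n : nat) (S : {set 'I_n}) (x : cube n) : {set cube n} :=
  [set y : cube n | [forall i, (i \notin S) ==> (y i == x i)]].

Definition is_code (d L n : nat) (C : {set cube n}) : Prop :=
  forall (S : {set 'I_n}) (x : cube n),
    #|S| = d -> (#|C :&: subcube S x| <= L)%N.

Definition admissible (R : realType) (d L : nat) : Prop :=
  exists2 eps : R, 0 < eps &
    forall n : nat, exists2 C : {set cube n},
      is_code d L C & eps * 2 ^+ n <= #|C|%:R.

Lemma card_cube (n : nat) : #|cube n| = (2 ^ n)%N.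
Proof. by rewrite card_ffun card_bool card_ord. Qed.

Lemma card_subcube (n : nat) (S : {set 'I_n}) (x : cube n) :
  #|subcube S x| = (2 ^ #|S|)%N.
Proof.
pose h (A : {set 'I_n}) : cube n := [ffun i => if i \in S then i \in A else x i].
rewrite -card_powerset -(@card_in_imset _ _ h (powerset S)); last first.
  move=> A B; rewrite !powersetE => sAS sBS /ffunP hAB.
  apply/setP => i; have := hAB i; rewrite !ffunE.
  case: (boolP (i \in S)) => // niS _.
  by rewrite (contraNF (subsetP sAS i) niS) (contraNF (subsetP sBS i) niS).
apply: eq_card => y; rewrite inE; apply/forallP/imsetP => [yx|[A _ ->] i].
  exists [set i in S | y i].
    by rewrite powersetE; apply/subsetP => i; rewrite inE => /andP[].
  apply/ffunP => i; rewrite ffunE inE; case: (boolP (i \in S)) => // niS.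
  by have := yx i; rewrite niS => /eqP.
by apply/implyP => /negbTE niS; rewrite ffunE niS.
Qed.

Lemma admissible_exp2 (R : realType) (d : nat) : admissible R d (2 ^ d).
Proof.
exists 1 => // n; exists [set: cube n].
  by move=> S x <-; rewrite setTI card_subcube.
by rewrite mul1r cardsT card_cube natrX.
Qed.

Lemma ex_admissible (R : realType) (d : nat) :
  exists L : nat, `[< admissible R d L >].
Proof. by exists (2 ^ d)%N; apply/asboolP/admissible_exp2. Qed.

(* L(d): the least admissible L.  Since d-dimensional subcubes have 2^d points,
   L = 2^d is always admissible and the minimum exists; negative integers are
   never admissible, so ranging over nat loses nothing. *)
Definition Lmin (R : realType) (d : nat) : nat := ex_minn (ex_admissible R d).

Lemma LminP (R : realType) (d : nat) :
  admissible R d (Lmin R d) /\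
  forall L : nat, admissible R d L -> (Lmin R d <= L)%N.
Proof.
rewrite /Lmin; case: ex_minnP => m /asboolP mP mmin; split=> // L LP.
exact/mmin/asboolP.
Qed.

(* Main.v *)
Require Import Defs.
From mathcomp Require Import all_boot all_order all_algebra.
From mathcomp Require Import reals.
From mathcomp Require Import zify.

(** Take [r] disjoint groups of coordinates and, for a word [w] choosing one
    coordinate from each group and a group [i], let [q i w] be the point whose
    support is [w] with its [i]-th choice omitted.  Some translate of a code of
    density at least [1/c] contains a proportion at least [1/c] of these points.
    If [r] is large, a positive proportion of the words [w] have at least [k]
    indices [i] with [q i w] in the translate, and by pigeonhole a positive
    proportion share the same [k]-set [I] of such indices.  A dense set of words
    contains a box with sides [A j] of size [t] (Erdos).  Freeing the [k * t]
    coordinates in the groups of [I] that lie in the sides, and fixing the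
    choices outside [I], gives a subcube with [k * t ^ (k - 1)] codewords: omit
    one group of [I] and choose freely in the [k - 1] others.  Translations map
    subcubes to subcubes, and the theorem is the case [t = 3]. *)

Set Implicit Arguments.
Unset Strict Implicit.
Unset Printing Implicit Defensive.

(** * Averaging and pigeonhole *)

(** Elements [w] with [#|g w| < k] account for at most half of the average, since
    [2 * c * k <= #|V|]. So a proportion [1 / (2 * c)] of [F] has [k <= #|g w|], and the most
    popular [k]-subset of [V] serves at least its share of these. *)
Lemma popular_subset (X L : finType) (F : {set X}) (V : {set L})
    (g : X -> {set L}) (c k : nat) :
    (forall w, w \in F -> g w \subset V) ->
    0 < c -> 0 < #|V| -> 2 * c * k <= #|V| ->
    #|V| * #|F| <= c * \sum_(w in F) #|g w| ->
  exists2 A : {set L}, #|A| = k &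
    #|F| <= 2 * c * 'C(#|V|, k) * #|[set w in F | A \subset g w]|.
Proof.
move=> gV c0 V0 kV avg.
pose E := [set w in F | k <= #|g w|].
have FE : #|F| <= 2 * c * #|E|.
  have : \sum_(w in F) #|g w| <= #|V| * #|E| + k * #|F|.
    rewrite (bigID (fun w => k <= #|g w|)) /= leq_add //.
      rewrite mulnC -sum_nat_const [leqRHS](eq_bigl (fun w => (w \in F) && (k <= #|g w|))).
        by apply: leq_sum => w /andP[wF _]; exact/subset_leq_card/gV.
      by move=> w; rewrite inE.
    rewrite [k * _]mulnC -sum_nat_const [leqRHS](bigID (fun w => k <= #|g w|)) /=.
    apply: leq_trans (leq_addl _ _).
    by apply: leq_sum => w /andP[_]; rewrite -ltnNge => /ltnW.
  move=> le1; rewrite -(leq_pmul2l V0); nia.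
pose P := [set A : {set L} | A \subset V & #|A| == k].
have cP : #|P| = 'C(#|V|, k) by rewrite cards_draws.
have P0 : 0 < #|P| by rewrite cP bin_gt0; nia.
pose h (A : {set L}) := #|[set w in F | A \subset g w]|.
have [A] := eq_bigmax_cond h P0.
rewrite inE => /andP[_ /eqP cA] maxA; exists A => //.
rewrite (leq_trans FE) // -[leqRHS]mulnA leq_pmul2l ?muln_gt0 ?c0 // -cP -/(h A) -maxA.
apply: leq_trans (_ : \sum_(B in P) h B <= _); last first.
  by rewrite -sum_nat_const; apply: leq_sum => B BP; exact: leq_bigmax_cond.
apply: leq_trans (_ : #|\bigcup_(B in P) [set w in F | B \subset g w]| <= _).
  apply/subset_leq_card/subsetP => w; rewrite inE => /andP[wF kw].
  have : 0 < #|[set B : {set L} | B \subset g w & #|B| == k]|.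
    by rewrite cards_draws bin_gt0.
  move=> /card_gt0P[B]; rewrite inE => /andP[Bg Bk].
  apply/bigcupP; exists B; rewrite inE ?wF //.
  by rewrite (subset_trans Bg (gV _ wF)).
rewrite /h; elim/big_rec2 : _ => [|B y s _ le]; first by rewrite cards0.
by rewrite (leq_trans (leq_card_setU _ _)) // leq_add2l.
Qed.

Import Order.TTheory GRing.Theory Num.Theory.

(** * Boxes in dense sets of words *)

Section Update.
Variables (J B : finType).
Implicit Types (w : {ffun J -> B}) (V : J -> {set B}).

Definition update w j a : {ffun J -> B} :=
  [ffun i => if i == j then a else w i].

Lemma update_familyE V w j a : a \in V j -> w \in family V -> update w j a \in family V.
Proof.
move=> aV /familyP wV; apply/familyP => i; rewrite ffunE.
by case: eqP => [->|_]; [exact: aV|exact: wV].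
Qed.

Lemma sum_update V j (D : {set {ffun J -> B}}) :
  \sum_(w in family V) #|[set a in V j | update w j a \in D]|
  = #|V j| * #|[set w in family V | w \in D]|.
Proof.
(* Writing [a] at [j] and recording the old value is an involution. *)
pose s (p : {ffun J -> B} * B) := (update p.1 j p.2, p.1 j).
have sK : involutive s.
  case=> w a; rewrite /s /=; congr pair; last by rewrite ffunE eqxx.
  by apply/ffunP => i; rewrite !ffunE; case: eqP => // ->.
under eq_bigr do rewrite -sum1_card big_mkcond.
under eq_bigr do under eq_bigr do rewrite inE.
transitivity (\sum_(p : {ffun J -> B} * B)
   if [&& p.1 \in family V, p.2 \in V j & update p.1 j p.2 \in D] then 1 else 0).
  rewrite -(pair_bigA _ (fun w a =>
    if [&& w \in family V, a \in V j & update w j a \in D] then 1 else 0)) /=.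
  rewrite big_mkcond; apply: eq_bigr => w _.
  by case: (w \in family V) => //=; rewrite big1.
rewrite (reindex_inj (inv_inj sK)) /=.
rewrite -(pair_bigA _ (fun w a =>
    if [&& update w j a \in family V, w j \in V j &
      update (update w j a) j (w j) \in D] then 1 else 0)) /=.
rewrite -[X in _ * X]sum1_card big_distrr [RHS]big_mkcond /=; apply: eq_bigr => w _.
rewrite inE muln1.
have wE a : update (update w j a) j (w j) = w.
  by have := sK (w, a) => -[].
have [wF /=|wF] := boolP (w \in family V); last first.
  rewrite big1 // => a _; case: ifP => // /and3P[uF wj _]; case/negP: wF.
  by rewrite -(wE a); apply: update_familyE.
have wj : w j \in V j by move/familyP: wF.
under eq_bigr do rewrite wE wj /=.
case: (w \in D); last by rewrite big1 // => a _; rewrite andbF.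
rewrite -big_mkcond sum1_card; apply: eq_card => a; rewrite unfold_in /= andbT.
apply/idP/idP => [/familyP/(_ j)|aV]; first by rewrite ffunE eqxx.
exact: update_familyE.
Qed.

End Update.

(** Here [c j] bounds the inverse of the density that remains after [j] sides are chosen. Choosing
    side [j] by [popular_subset] needs [2 * c j * t] values and multiplies this bound by
    [2 * 'C(#|V j|, t)]. *)
Lemma dense_family_box (r t : nat) (B : finType) (V : 'I_r -> {set B})
    (c : nat -> nat) (D : {set {ffun 'I_r -> B}}) :
    0 < t -> (forall j, 0 < c j) ->
    (forall j : 'I_r, 2 * c j * t <= #|V j|) ->
    (forall j : 'I_r, 2 * c j * 'C(#|V j|, t) <= c j.+1) ->
    #|family V| <= c 0 * #|[set w in family V | w \in D]| ->
  exists2 A : 'I_r -> {set B}, (forall j, #|A j| = t) &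
    forall u, u \in family A -> u \in D.
Proof.
move=> t0 c0 cV cS dD.
pose F := [set w in family V].
have cF : #|F| = #|family V| by apply: eq_card => w; rewrite inE.
have V0 j : 0 < #|V j| by apply: leq_trans (cV j); rewrite !muln_gt0 c0 t0.
(* The sides are found one coordinate at a time; the words of [E] are those for
   which every choice in the first [l] sides stays in [D].  Later groups are
   much larger than earlier ones, to make up for the loss of density. *)
have main l : l <= r -> exists2 A : 'I_r -> {set B},
    (forall j : 'I_r, j < l -> #|A j| = t) &
    exists2 E : {set {ffun 'I_r -> B}},
      (forall w u : {ffun 'I_r -> B}, w \in E -> (forall j : 'I_r, j < l -> u j \in A j) ->
        (forall j : 'I_r, l <= j -> u j = w j) -> u \in D) &
      #|F| <= c l * #|[set w in F | w \in E]|.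
  elim: l => [_|l IH lr].
    exists (fun=> set0) => //; exists D.
      move=> w u wD _ uw; suff -> : u = w by [].
      by apply/ffunP => j; exact: uw.
    rewrite cF (leq_trans dD) // leq_pmul2l //.
    by apply: subset_leq_card; apply/subsetP => w; rewrite !inE.
  have [A At [E EP dE]] := IH (ltnW lr).
  pose j0 := Ordinal lr.
  (* By [sum_update], the average number of values at [j0] that bring [w] into [E] is [#|V j0|]
     times the density of [E]; so some [t] values all work for many words. *)
  have [||||//|A0 A0t dA0] := @popular_subset _ _ F (V j0)
     (fun w => [set a in V j0 | update w j0 a \in E]) (c l) t.
  - by move=> w _; apply/subsetP => a; rewrite inE => /andP[].
  - exact: c0.
  - exact: V0.
  - exact: (cV j0).
  - under eq_bigl do rewrite inE.
    rewrite sum_update mulnCA leq_pmul2l //.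
    apply: leq_trans dE _; rewrite leq_pmul2l //.
    by apply: subset_leq_card; apply/subsetP => w; rewrite !inE.
  exists (fun j => if j == j0 then A0 else A j).
    move=> j; rewrite ltnS leq_eqVlt -val_eqE /=.
    by case: eqP => [_ _|_ /At].
  exists [set w | A0 \subset [set a in V j0 | update w j0 a \in E]].
    move=> w u; rewrite inE => /subsetP wA uA uw.
    have uA0 : u j0 \in A0 by have := uA j0; rewrite eqxx; apply.
    have := wA _ uA0; rewrite inE => /andP[_ wE].
    apply: (EP _ u wE) => j jl.
      by have := uA j (ltnW jl); rewrite -val_eqE /= ltn_eqF.
    rewrite ffunE; case: eqP => [->//|/eqP nj]; apply: uw.
    by rewrite ltn_neqAle jl andbT eq_sym; rewrite -val_eqE in nj.
  apply: leq_trans dA0 _; apply: leq_mul; first exact: (cS j0).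
  by apply: subset_leq_card; apply/subsetP => w; rewrite !inE.
have [A At [E EP dE]] := main r (leqnn r).
have [w wE] : exists w, w \in E.
  have : 0 < #|[set w in F | w \in E]|.
    have : 0 < #|F| by rewrite cF card_family foldrE big_map big_enum prodn_cond_gt0.
    by move=> /leq_trans/(_ dE); rewrite muln_gt0 => /andP[].
  by move=> /card_gt0P[w]; rewrite inE => /andP[_ ?]; exists w.
exists A => [j|u /familyP uA]; first exact: At.
by apply: (EP w u wE) => j; [move=> _; exact: uA|rewrite leqNgt ltn_ord].
Qed.

(** * Translates of the code *)

Definition shift (n : nat) (x y : cube n) : cube n := [ffun i => x i (+) y i].

Lemma shiftK n (y : cube n) : involutive (fun x => shift x y).
Proof. by move=> x; apply/ffunP => i; rewrite !ffunE addbK. Qed.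

Lemma shiftI n (x : cube n) : injective (shift x).
Proof.
by move=> y z /ffunP e; apply/ffunP => i; have := e i; rewrite !ffunE => /addbI.
Qed.

(** Each [q p] is moved into [C] by exactly [#|C|] translations, so the best translation does at
    least as well as the average. Points count with multiplicity, as [omit_point i w] does not
    depend on [w i]. *)
Lemma dense_shift (n c : nat) (C : {set cube n}) (P : finType) (F : {set P})
    (q : P -> cube n) :
  2 ^ n <= c * #|C| ->
  exists x, #|F| <= c * \sum_(p in F) (shift x (q p) \in C).
Proof.
move=> dC; pose h (x : cube n) := \sum_(p in F) (shift x (q p) \in C).
have sh : \sum_x h x = #|F| * #|C|.
  rewrite exchange_big -sum_nat_const; apply: eq_bigr => /= p _.
  rewrite -sum1_card [RHS]big_mkcond [RHS](reindex_inj (inv_inj (shiftK (q p)))) /=.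
  by apply: eq_bigr => x _; case: (_ \in C).
have [|x _ maxx] := @eq_bigmax_cond _ (fun=> true) h.
  by apply/card_gt0P; exists [ffun=> false].
exists x; rewrite -/(h x) -maxx.
have : \sum_x h x <= 2 ^ n * \max_(x in fun=> true) h x.
  rewrite -card_cube -sum_nat_const; apply: leq_sum => y _.
  exact: (@leq_bigmax_cond _ (fun=> true) h).
rewrite sh => le; rewrite -(@leq_pmul2l (2 ^ n)) ?expn_gt0 //.
apply: leq_trans (leq_mul dC (leqnn #|F|)) _.
by rewrite [leqRHS]mulnCA -mulnA leq_mul2l mulnC le orbT.
Qed.

(** * Many codewords in one subcube *)

Section OmittedPoints.
Variables r M : nat.
Local Notation coord := ('I_r * 'I_M)%type.
Local Notation word := {ffun 'I_r -> 'I_M}.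

Definition omit_point (i : 'I_r) (w : word) : cube #|{: coord}| :=
  [ffun s => let: (j, b) := enum_val s in (j != i) && (w j == b)].

Lemma omit_pointE i w j b :
  omit_point i w (enum_rank (j, b)) = (j != i) && (w j == b).
Proof. by rewrite ffunE enum_rankK. Qed.

Lemma omit_point_update i w a : omit_point i (update w i a) = omit_point i w.
Proof.
apply/ffunP => s; rewrite !ffunE; case: (enum_val s) => j b.
by rewrite ffunE; case: eqP.
Qed.

(** The points counted are distinct: the omitted group is the only one that the support misses, and
    the support shows all other choices. *)
Lemma omitted_box_card (x : cube #|{: coord}|) (C : {set cube #|{: coord}|})
    (I : {set 'I_r}) (A : 'I_r -> {set 'I_M}) (t L : nat) :
    0 < t -> (forall j, #|A j| = t) ->
    (forall i u, i \in I -> u \in family A -> shift x (omit_point i u) \in C) ->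
    is_code (#|I| * t) L C ->
  #|I| * t ^ #|I|.-1 <= L.
Proof.
move=> t0 At IC codeC.
have [a aA] : exists a : 'I_r -> 'I_M, forall j, a j \in A j.
  by apply: (@fin_all_exists _ _ (fun j b => b \in A j)) => j;
    apply/card_gt0P; rewrite At.
pose S' := [set p : coord | (p.1 \in I) && (p.2 \in A p.1)].
pose S := [set s : 'I_#|{: coord}| | enum_val s \in S'].
have cS : #|S| = #|I| * t.
  have -> : #|S| = #|S'|.
    have -> : S = enum_val @^-1: S' by apply/setP => s; rewrite !inE.
    apply: on_card_preimset; exists enum_rank => p _;
      [exact: enum_valK|exact: enum_rankK].
  rewrite -sum1_card (eq_bigl (fun p : coord => (p.1 \in I) && (p.2 \in A p.1))).
    rewrite -(pair_big_dep (fun i => i \in I) (fun i b => b \in A i) (fun _ _ => 1)) /=.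
    by rewrite -sum_nat_const; apply: eq_bigr => i _; rewrite sum1_card At.
  by move=> p; rewrite inE.
(* Entry [i] is invisible in the point that omits group [i], so it is pinned to [a i] to avoid
   counting that point [t] times. *)
pose V i j := if (j \in I) && (j != i) then A j else [set a j].
have VA i j : V i j \subset A j.
  by rewrite /V; case: ifP => // _; rewrite sub1set.
have cV i : i \in I -> #|family (V i)| = t ^ #|I|.-1.
  move=> iI; rewrite card_family foldrE big_map big_enum /=.
  rewrite (bigID (mem (I :\ i))) /= [X in _ * X]big1 ?muln1; last first.
    by move=> j; rewrite !inE andbC => /negPf; rewrite /V => ->; rewrite cards1.
  have -> : #|I|.-1 = #|I :\ i| by rewrite (cardsD1 i I) iI.
  rewrite -prod_nat_const; apply: eq_bigr => j; rewrite !inE andbC /V => ->.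
  exact: At.
pose Z := [set z : 'I_r * word | (z.1 \in I) && (z.2 \in family (V z.1))].
have cZ : #|Z| = #|I| * t ^ #|I|.-1.
  rewrite -sum1_card (eq_bigl (fun z : 'I_r * word => (z.1 \in I) && (z.2 \in family (V z.1)))).
    rewrite -(pair_big_dep (fun i => i \in I) (fun i w => w \in family (V i)) (fun _ _ => 1)) /=.
    by rewrite -sum_nat_const; apply: eq_bigr => i iI; rewrite sum1_card cV.
  by move=> z; rewrite inE.
pose p (z : 'I_r * word) := shift x (omit_point z.1 z.2).
have pI : {in Z &, injective p}.
  move=> [i w] [j v]; rewrite !inE /= => /andP[iI /familyP wV] /andP[jI /familyP vV].
  move=> /shiftI /ffunP /= e.
  have ij : i = j.
    (* At this coordinate the point omitting [i] is zero, while the one omitting [j] is one. *)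
    apply/eqP/idPn => nij; have := e (enum_rank (i, v i)).
    by rewrite !omit_pointE eqxx nij eqxx.
  rewrite -ij in vV e *; congr pair; apply/ffunP => l.
  have [->|nli] := eqVneq l i.
    have := wV i; have := vV i.
    by rewrite /V eqxx andbF !inE => /eqP -> /eqP ->.
  have := e (enum_rank (l, w l)); rewrite !omit_pointE nli eqxx /=.
  by move/esym/eqP.
(* Base point: the choices [a] outside [I], zero on the groups of [I]. In those groups a coordinate
   that is not free lies off the side, where all the points vanish. *)
pose y : cube #|{: coord}| :=
  [ffun s => let: (j, b) := enum_val s in (j \notin I) && (a j == b)].
have := codeC S (shift x y) cS; apply: leq_trans.
rewrite -cZ -(card_in_imset pI); apply/subset_leq_card/subsetP => v /imsetP[[i w]].
rewrite inE /= => /andP[iI /familyP wV] -> {v}.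
have wA : w \in family A by apply/familyP => j; apply: (subsetP (VA i j)); exact: wV.
rewrite inE IC //= inE; apply/forallP => s; apply/implyP.
rewrite inE !ffunE; case: (enum_val s) => j b /=; rewrite inE /= => nS.
apply/eqP; congr (_ (+) _).
have [jI|njI] := boolP (j \in I); last first.
  have := wV j; rewrite /V (negPf njI) inE => /eqP -> /=.
  by case: eqP => // ji; rewrite ji iI in njI.
apply/negP => /andP[_ /eqP wb]; rewrite jI -wb /= in nS.
by case/negP: nS; move/familyP: wA; apply.
Qed.

End OmittedPoints.

(** * Choice of parameters and conclusion *)

Lemma admissible_nat (R : realType) (d L : nat) : admissible R d L ->
  exists2 c : nat, 0 < c &
    forall n, exists2 C : {set cube n}, is_code d L C & 2 ^ n <= c * #|C|.
Proof.
case=> eps eps0 epsC; pose c := (Num.bound (eps^-1)%R).+1.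
exists c => // n; have [C codeC dC] := epsC n; exists C => //.
have ce : (1 <= c%:R * eps)%R.
  rewrite -ler_pdivrMr // mul1r (le_trans (ltW (archi_boundP _))) //.
    by rewrite invr_ge0 ltW.
  by rewrite ler_nat.
rewrite -(ler_nat R) natrX natrM.
rewrite (le_trans _ (ler_wpM2l (ler0n _ c) dC)) // mulrA ler_peMl //.
by rewrite exprn_ge0.
Qed.

Lemma admissible_lower_bound (R : realType) (k t L : nat) :
  0 < k -> 0 < t -> admissible R (k * t) L -> k * t ^ k.-1 <= L.
Proof.
move=> k0 t0 /admissible_nat[c c0 cC].
(* Enough groups for [popular_subset] to find [k] good indices. *)
pose r := 2 * c * k.
(* The inverse density after one more side, for a group of size [2 * e * t]. The initial value
   [2 * c * 'C(r, k)] is the cost of choosing [I]. *)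
pose next e := 2 * e * 'C(2 * e * t, t).
pose d j := iter j next (2 * c * 'C(r, k)).
have d0 j : 0 < d j.
  elim: j => [|j IH]; rewrite /d /=.
    by rewrite !muln_gt0 c0 bin_gt0 /r; nia.
  by rewrite /next !muln_gt0 bin_gt0 -/(d j) IH; nia.
pose m j := 2 * d j * t.
pose M := \max_(j < r) m j.
(* The groups grow with [j] but share the type ['I_M]; words use only the first [m j] elements of
   group [j]. *)
pose V (j : 'I_r) : {set 'I_M} := [set b : 'I_M | b < m j].
have cV j : #|V j| = m j.
  have mM : m j <= M by exact: (@leq_bigmax _ (fun j : 'I_r => m j) j).
  have -> : V j = widen_ord mM @: setT.
    apply/setP => b; rewrite inE; apply/idP/imsetP => [bm|[b' _ ->]]; last exact: (ltn_ord b').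
    by exists (Ordinal bm) => //; exact: val_inj.
  by rewrite card_imset ?cardsT ?card_ord // => b b' [/val_inj].
have [C codeC dC] := cC #|{: 'I_r * 'I_M}|.
pose F := [set p : 'I_r * {ffun 'I_r -> 'I_M} | p.2 \in family V].
have [x dx] := dense_shift F (fun p => omit_point p.1 p.2) dC.
pose G := [set w in family V].
have cG : #|G| = #|family V| by apply: eq_card => w; rewrite inE.
pose g w := [set i : 'I_r | shift x (omit_point i w) \in C].
have FE (h : 'I_r -> {ffun 'I_r -> 'I_M} -> nat) :
    \sum_(p in F) h p.1 p.2 = \sum_(w in G) \sum_i h i w.
  rewrite exchange_big pair_big_dep /=; apply: eq_bigl => p.
  by rewrite !inE.
have [||||//|I cI dI] := @popular_subset _ _ G setT g c k.
- by move=> w _; exact: subsetT.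
- exact: c0.
- by rewrite cardsT card_ord /r; nia.
- by rewrite cardsT card_ord.
- rewrite cardsT card_ord.
  have cF : #|F| = r * #|G|.
    rewrite -sum1_card (FE (fun _ _ => 1)) mulnC -sum_nat_const.
    by apply: eq_bigr => w _; rewrite sum1_card card_ord.
  rewrite -cF (leq_trans dx) // (FE (fun i w => (shift x (omit_point i w) \in C) : nat)).
  rewrite leq_mul2l; apply/orP; right; apply: leq_sum => w _.
  by rewrite -sum1_card [leqRHS]big_mkcond; apply: leq_sum => i _; rewrite inE; case: (_ \in C).
have [|||A At AD] := @dense_family_box r t _ V d [set w | I \subset g w] t0 d0.
- by move=> j; rewrite cV.
- by move=> j; rewrite cV.
- rewrite -cG (leq_trans dI) // cardsT card_ord leq_mul //.
  by apply/subset_leq_card/subsetP => w; rewrite !inE.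
rewrite -cI; apply: (@omitted_box_card r M x C I A t L) => //; last by rewrite cI.
by move=> i u iI /AD; rewrite inE => /subsetP/(_ i iI); rewrite inE.
Qed.

Theorem mainTheorem3 (R : realType) :
  exists d0 : nat, forall d : nat,
    (d0 <= d)%N -> (3 %| d)%N ->
    (d * 3 ^ ((d - 6) %/ 3) <= Lmin R d)%N.
Proof.
exists 6 => d d6 /dvdnP[k dk]; rewrite dk in d6 *.
have [adm _] := LminP R (k * 3).
apply: leq_trans (admissible_lower_bound _ _ adm) => //; last by lia.
(* The threshold 6 gives [2 <= k], so [k.-2] does not truncate and the two bounds coincide. *)
have [-> ->] : (k * 3 - 6) %/ 3 = k.-2 /\ k.-1 = k.-2.+1 by lia.
by rewrite expnS mulnA.
Qed.
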